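(* If the convex hull $H(\Lambda)$ of a closed set $\Lambda\subset\mathbb{S}^n$ contains a horoball, then $h_c(\Lambda)\geq n/2$. In particular, for any Kleinian group $G$ acting on $\mathbb{B}^{n+1}$ with the property that the convex hull $H(\Lambda(G))$ of its limit set contains a horoball, one has $$h_c(\Lambda(G))\geq \frac{n}{2}.$$
   Context: Let $n\ge 1$. $(\mathbb{B}^{n+1},d)$ is the unit ball model of $(n+1)$-dimensional hyperbolic space, with boundary at infinity the unit sphere $\mathbb{S}^n$; $\mathrm{vol}$ is hyperbolic volume and $B_R(z)$ the hyperbolic ball of centre $z$ and radius $R$. A horoball is an open $(n+1)$-dimensional Euclidean ball in $\mathbb{B}^{n+1}$ whose bounding sphere is tangent to $\mathbb{S}^n$. A Kleinian group is a discrete subgroup of the group of orientation preserving isometries of $\mathbb{B}^{n+1}$; its limit set $\Lambda(G)\subset\mathbb{S}^n$ is the set of accumulation points of any $G$-orbit. For a closed set $\Lambda\subset\mathbb{S}^n$, the convex hull $H(\Lambda)\subset\mathbb{B}^{n+1}$ is the hyperbolic convex hull of the union of all geodesics both of whose end points lie in $\Lambda$, and $H_\varepsilon(\Lambda)$ is its $\varepsilon$-neighbourhood, $\varepsilon>0$. The convex core entropy of $\Lambda$ is $$h_c(\Lambda)=\limsup_{R\to\infty}\frac{\log \mathrm{vol}(B_R(z)\cap H_\varepsilon(\Lambda))}{R},$$ which is independent of $z\in\mathbb{B}^{n+1}$ and of $\varepsilon>0$. *)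

(* Defs.v *)
From HB Require Import structures.
From mathcomp Require Import all_boot all_order all_algebra.
From mathcomp Require Import all_classical all_reals all_analysis.

Set Implicit Arguments.
Unset Strict Implicit.
Unset Printing Implicit Defensive.

Import Order.TTheory GRing.Theory Num.Theory.
Import numFieldNormedType.Exports.
Local Open Scope classical_set_scope.
Local Open Scope ring_scope.

Section lebesgue_tuple.
Context {R : realType}.
Local Notation RT := (measurableTypeR R).
Local Open Scope ereal_scope.

Definition tuple_cons n (p : RT * n.-tuple RT) : n.+1.-tuple RT :=
  [tuple of p.1 :: p.2].

Lemma measurable_tuple_cons n : measurable_fun setT (@tuple_cons n).
Proof. exact: measurable_cons. Qed.

Lemma thead_tuple_cons n p : thead (@tuple_cons n p) = p.1.
Proof. exact: theadE. Qed.

Lemma behead_tuple_cons n p : [tuple of behead (@tuple_cons n p)] = p.2.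
Proof. exact: val_inj. Qed.

Section step.
Context n (mu : {sigma_finite_measure set (n.-tuple RT) -> \bar R}).

Definition lebesgue_step : set (n.+1.-tuple RT) -> \bar R :=
  pushforward ((@lebesgue_measure R) \x mu) (@tuple_cons n).

Let step_measure :=
  measure_function_pushforward__canonical__measure_function_Measure
    ((@lebesgue_measure R) \x mu) (@measurable_tuple_cons n).

HB.instance Definition _ := isMeasure.Build _ _ _ lebesgue_step
  (measure0 step_measure) (measure_ge0 step_measure)
  (@measure_semi_sigma_additive _ _ _ step_measure).

Lemma lebesgue_step_sigma_finite : sigma_finite setT lebesgue_step.
Proof.
have [F [FT ndF mF]] := (sigma_finiteP _ _).1 (sigma_finiteT (@lebesgue_measure R)).
have [G [GT ndG mG]] := (sigma_finiteP _ _).1 (sigma_finiteT mu).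
have mh : measurable_fun setT (fun t : n.+1.-tuple RT => thead t).
  exact: measurable_tnth.
have mb := @measurable_behead _ RT n.
exists (fun k => [set t : n.+1.-tuple RT |
   F k (thead t) /\ G k [tuple of behead t]]).
  apply/seteqP; split => // t _.
  have : setT (thead t) by [].
  rewrite FT => -[i _ Fi].
  have : setT [tuple of behead t] by [].
  rewrite GT => -[j _ Gj].
  exists (maxn i j) => //=; split.
    by apply: (subsetPset _ _ (ndF _ _ (leq_maxl i j))).
  by apply: (subsetPset _ _ (ndG _ _ (leq_maxr i j))).
move=> k; have [mFk Fk] := mF k; have [mGk Gk] := mG k; split.
  rewrite (_ : [set _ | _] = (setT `&` (fun t : n.+1.-tuple RT => thead t) @^-1` F k)
     `&` (setT `&` (fun t : n.+1.-tuple RT => [tuple of behead t]) @^-1` G k)).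
    by apply: measurableI; [exact: mh|exact: mb].
  by rewrite !setTI.
rewrite /lebesgue_step /pushforward (_ : _ @^-1` _ = F k `*` G k).
  by rewrite product_measure1E // lte_mul_pinfty // ge0_fin_numE.
by apply/seteqP; split=> -[x t] /=; rewrite thead_tuple_cons behead_tuple_cons.
Qed.

HB.instance Definition _ := @Measure_isSigmaFinite.Build _ _ _ lebesgue_step
  lebesgue_step_sigma_finite.

End step.

Fixpoint lebesgue_tuple n : {sigma_finite_measure set (n.-tuple RT) -> \bar R} :=
  match n with
  | 0 => \d_([tuple] : 0.-tuple RT)
  | n'.+1 => lebesgue_step (lebesgue_tuple n')
  end.

End lebesgue_tuple.

Section ball_model.
Context {R : realType} {m : nat}.
Local Notation V := 'rV[R]_m.
Implicit Types (x y z : V) (A C L : set V) (g : V -> V).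

(* The library norm on 'rV[R]_m is the sup norm; it induces the usual topology
   and differential calculus, but lengths and spheres are Euclidean. *)
Definition enorm x : R := Num.sqrt (\sum_i x ord0 i ^+ 2).

Definition eball x r : set V := [set y | enorm (y - x) < r].
Definition esphere x r : set V := [set y | enorm (y - x) = r].

Definition unit_ball : set V := eball 0 1.
Definition unit_sphere : set V := esphere 0 1.

Definition arcosh (u : R) : R := ln (u + Num.sqrt (u ^+ 2 - 1)).

(* Distance of the metric 2 |dx| / (1 - |x|^2), of curvature -1. *)
Definition hdist x y : R :=
  arcosh (1 + 2 * enorm (x - y) ^+ 2 /
              ((1 - enorm x ^+ 2) * (1 - enorm y ^+ 2))).

Definition hball z r : set V := [set x | unit_ball x /\ hdist z x < r].

(* Riemannian volume of the metric above, for A contained in the unit ball. *)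
Definition hvol A : \bar R :=
  let pt (t : m.-tuple (measurableTypeR R)) : V := \row_i tnth t i in
  (\int[lebesgue_tuple m]_(t in [set t | A (pt t)])
    ((2 / (1 - enorm (pt t) ^+ 2)) ^+ m)%:E)%E.

Definition geodesic_line (c : R -> V) : Prop :=
  (forall t, unit_ball (c t)) /\
  (forall s t, hdist (c s) (c t) = `|s - t|).

Definition geodesics_in L : set V :=
  [set x | exists c : R -> V, [/\ geodesic_line c,
     exists2 a, L a & c t @[t --> +oo] --> a,
     exists2 b, L b & c t @[t --> -oo] --> b
   & range c x]].

(* Any two points of hyperbolic space lie on a complete geodesic. *)
Definition hconvex C : Prop :=
  C `<=` unit_ball /\
  forall c s t u, geodesic_line c -> s <= t <= u ->
    C (c s) -> C (c u) -> C (c t).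

Definition hull L : set V := smallest hconvex (geodesics_in L).

Definition hneighborhood (e : R) A : set V :=
  [set x | unit_ball x /\ exists2 y, A y & hdist x y < e].

Definition core_entropy_at z (e : R) L : \bar R :=
  limf_esup (fun r : R =>
    lne (hvol (hball z r `&` hneighborhood e (hull L))) * (r^-1)%:E)%E
    (pinfty_nbhs R).

Definition horoball : set (set V) :=
  [set B | exists a r, [/\ 0 < r, B = eball a r, B `<=` unit_ball
    & exists xi, esphere a r `&` unit_sphere = [set xi]]].

(* An isometry of the ball is represented by its extension by the identity, so
   that composition, inverses and equality are those of total functions. *)
Definition hisometry g : Prop :=
  [/\ forall x, ~ unit_ball x -> g x = x,
      g @` unit_ball = unit_ball
    & forall x y, unit_ball x -> unit_ball y -> hdist (g x) (g y) = hdist x y].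

Definition orientation_preserving g : Prop :=
  forall x, unit_ball x -> differentiable g x /\ 0 < \det ('J g x).

Definition isometry_group (G : set (V -> V)) : Prop :=
  [/\ forall g, G g -> hisometry g /\ orientation_preserving g,
      G idfun,
      forall g h, G g -> G h -> G (g \o h)
    & forall g, G g -> exists h, [/\ G h, h \o g = idfun & g \o h = idfun]].

Definition compact_in_ball : set (set V) :=
  [set K | compact K /\ K `<=` unit_ball].

(* Discreteness for the topology of uniform convergence on the compact subsets
   of the open ball. *)
Definition kleinian (G : set (V -> V)) : Prop :=
  isometry_group G /\
  forall g, G g -> isolated (G : set {family compact_in_ball, V -> V}) g.

Definition orbit_of (G : set (V -> V)) z : set V := [set g z | g in G].

Definition limit_set_at (G : set (V -> V)) z : set V :=
  unit_sphere `&` limit_point (orbit_of G z).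

End ball_model.

(* Main.v *)
Require Import Defs.
From mathcomp Require Import all_boot all_order all_algebra.
From mathcomp Require Import all_classical all_reals all_analysis.
From mathcomp Require Import ring lra.

Import Order.TTheory GRing.Theory Num.Theory.
Import numFieldNormedType.Exports.
Local Open Scope classical_set_scope.
Local Open Scope ring_scope.

(** A horoball alone has enough volume: near its tangency point [xi], the points
    at Euclidean depth about [s] below [xi] and within about [sqrt s] of [xi] lie
    in the horoball and at hyperbolic distance at most [- ln s + O(1)] from any
    fixed centre.  This slab contains about [s ^ (- n / 2)] disjoint Euclidean
    cubes of side [s], each of hyperbolic volume bounded below independently of
    [s] since the density there is about [s ^ (- n.+1)].  Taking [s] of order
    [expR (- r)] gives volume at least [c * expR (n * r / 2)] inside the ball of
    radius [r]. *)

(** * Volume bounds from disjoint cubes *)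

(* [D] need not be measurable: the integral of a nonnegative function is a
   supremum over the simple functions below it. *)
Lemma ge0_integral_ge_cst {d : measure_display} {T : measurableType d}
    {R : realType} (mu : {measure set T -> \bar R}) (D E : set T)
    (f : T -> \bar R) (c : R) :
  measurable E -> E `<=` D -> 0 <= c ->
  (forall x, D x -> (0 <= f x)%E) -> (forall x, E x -> (c%:E <= f x)%E) ->
  (c%:E * mu E <= \int[mu]_(x in D) f x)%E.
Proof.
move=> mE ED c0 f0 cf.
have ge0c x : E x -> (0 <= (cst c%:E : T -> \bar R) x)%E by rewrite lee_fin.
rewrite -integral_cst// !ge0_integralE//.
apply: le_ereal_sup => _ [h hc <-]; exists h => // x.
apply: (le_trans (hc x)); rewrite /patch.
case: ifPn => xE; case: ifPn => xD //.
- by apply: cf; exact: set_mem.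
- by move: xD; rewrite notin_setE => /(_ (ED _ (set_mem xE))).
- by apply: f0; exact: set_mem.
Qed.

Definition cube {R : realType} {m : nat} (c : 'I_m -> R) (s : R) :
  set (m.-tuple (measurableTypeR R)) :=
  [set t | forall j, c j <= tnth t j < c j + s].

Lemma measurable_cube {R : realType} {m : nat} (c : 'I_m -> R) (s : R) :
  measurable (cube c s).
Proof.
have -> : cube c s = \bigcap_(j in [set: 'I_m])
    ((fun t : m.-tuple (measurableTypeR R) => tnth t j) @^-1`
      [set` `[c j, c j + s[]).
  apply/seteqP; split => [t ct i _|t ct j] /=; first by rewrite in_itv/=; exact: ct.
  by have := ct j I; rewrite /= in_itv.
apply: fin_bigcap_measurable => // j _; rewrite -[X in measurable X]setTI.
by apply: (measurable_tnth j) => //; exact: measurable_itv.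
Qed.

Lemma lebesgue_tuple_cube {R : realType} {m : nat} (c : 'I_m -> R) (s : R) :
  0 <= s -> lebesgue_tuple m (cube c s) = (s ^+ m)%:E.
Proof.
move=> s0; elim: m c => [|m IH] c /=.
  rewrite expr0 /= diracE mem_set//=.
  by case.
rewrite /lebesgue_step /pushforward.
have -> : @tuple_cons R m @^-1` cube c s =
    [set` `[c ord0, c ord0 + s[] `*` cube (fun j => c (lift ord0 j)) s.
  apply/seteqP; split => [[x t] ct|[x t] [/= cx ct] j].
    split => [|j] /=; first by have := ct ord0; rewrite in_itv/= tnth0.
    by have := ct (lift ord0 j); rewrite tnthS.
  case: (unliftP ord0 j) => [j' ->|->]; last by rewrite tnth0; move: cx; rewrite in_itv.
  by rewrite tnthS; exact: ct.
rewrite product_measure1E//; last exact: measurable_cube.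
rewrite IH [X in (X * _)%E](lebesgue_measure_itv `[c ord0, c ord0 + s[) /= lte_fin exprS.
case: ltP => [_|h]; first by rewrite -EFinB addrAC subrr add0r -EFinM.
(* The interval is empty and has measure 0, which agrees with [s ^+ m.+1] at [s = 0]. *)
have -> : s = 0 by apply/eqP; rewrite eq_le s0 andbT; move: h; rewrite gerDl.
by rewrite mul0r mul0e.
Qed.

(** Two points of one half-open cube differ by less than [s] in each entry, so corners at distance
    at least [s] in some entry give disjoint cubes. The Lebesgue measures [s ^+ m] then add up, and
    [w] bounds the hyperbolic density on each cube from below. *)
Lemma hvol_ge_cubes {R : realType} {m : nat} {I : finType}
    (c : I -> 'I_m -> R) (s w : R) (A : set 'rV[R]_m) :
  0 <= s -> 0 <= w -> A `<=` unit_ball ->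
  (forall k k', k != k' -> exists j, s <= `|c k j - c k' j|) ->
  (forall k (x : 'rV[R]_m), (forall j, c k j <= x ord0 j < c k j + s) ->
    A x /\ w <= (2 / (1 - enorm x ^+ 2)) ^+ m) ->
  ((#|I|%:R * (s ^+ m * w))%:E <= hvol A)%E.
Proof.
move=> s0 w0 Aball sep cA; rewrite /hvol.
have cubeA k t : cube (c k) s t ->
    A (\row_i tnth t i) /\ w <= (2 / (1 - enorm (\row_i tnth t i) ^+ 2)) ^+ m.
  by move=> ct; apply: (cA k) => j; rewrite mxE; exact: ct.
have fI : finite_set [set: I] by exact: finite_finset.
have mU : measurable (\bigcup_(k in [set: I]) cube (c k) s).
  by apply: fin_bigcup_measurable => // k _; exact: measurable_cube.
have -> : (#|I|%:R * (s ^+ m * w))%:E =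
    (w%:E * lebesgue_tuple m (\bigcup_(k in [set: I]) cube (c k) s))%E.
  rewrite measure_fin_bigcup//; last 2 first.
  - move=> k k' _ _ [t [/= tk tk']]; apply/eqP; apply: contraT => /sep[j sj].
    have := tk j; have := tk' j => /andP[? ?] /andP[? ?].
    by move: sj; rewrite leNgt ltr_distl; case: andP => // -[]; split; lra.
  - by move=> k _; exact: measurable_cube.
  rewrite (fsbigE (index_enum I)) ?index_enum_uniq//; last first.
    by move=> i _; rewrite mem_index_enum.
  rewrite (eq_bigr (fun=> (s ^+ m)%:E)); last first.
    by move=> k _; exact: lebesgue_tuple_cube.
  rewrite (eq_bigl predT) => [|k]; last by rewrite in_setT.
  rewrite sumEFin sumr_const -EFinM -[in RHS]mulr_natl; congr EFin.
  by rewrite [in RHS](_ : #|_| = #|I|)//; ring.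
apply: ge0_integral_ge_cst => //.
- by move=> t [k _ /cubeA[]].
- move=> t /= /Aball; rewrite /unit_ball /eball/= subr0 => t1.
  rewrite lee_fin exprn_ge0// divr_ge0// subr_ge0 expr_le1//; first exact: ltW.
  exact: sqrtr_ge0.
- by move=> t [k _ /cubeA[]].
Qed.

(** * The Euclidean inner product *)

Definition dot {R : realType} {m : nat} (x y : 'rV[R]_m) : R :=
  \sum_i x ord0 i * y ord0 i.

Section dot.
Context {R : realType} {m : nat}.
Implicit Types (x y z : 'rV[R]_m) (a : R).

Lemma dotC x y : dot x y = dot y x.
Proof. by apply: eq_bigr => i _; rewrite mulrC. Qed.

Lemma dotDl x y z : dot (x + y) z = dot x z + dot y z.
Proof. by rewrite -big_split; apply: eq_bigr => i _; rewrite mxE mulrDl. Qed.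

Lemma dotZl a x y : dot (a *: x) y = a * dot x y.
Proof. by rewrite mulr_sumr; apply: eq_bigr => i _; rewrite mxE mulrA. Qed.

Lemma dotNl x y : dot (- x) y = - dot x y.
Proof. by rewrite -scaleN1r dotZl mulN1r. Qed.

Lemma dotDr x y z : dot x (y + z) = dot x y + dot x z.
Proof. by rewrite dotC dotDl !(dotC x). Qed.

Lemma dotZr a x y : dot x (a *: y) = a * dot x y.
Proof. by rewrite dotC dotZl dotC. Qed.

Lemma dotNr x y : dot x (- y) = - dot x y.
Proof. by rewrite dotC dotNl dotC. Qed.

Definition dotE := (dotDl, dotDr, dotNl, dotNr, dotZl, dotZr).

Lemma dotxx_ge0 x : 0 <= dot x x.
Proof. by apply: sumr_ge0 => i _; rewrite -expr2 sqr_ge0. Qed.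

Lemma dotxx_eq0 x : dot x x = 0 -> x = 0.
Proof.
move=> /eqP; rewrite psumr_eq0; last by move=> i _; rewrite -expr2 sqr_ge0.
move=> /allP x0; apply/rowP => i; rewrite mxE.
by have /eqP := implyP (x0 i (mem_index_enum _)) isT;
  move=> /eqP; rewrite mulf_eq0 orbb => /eqP.
Qed.

Lemma enormE x : enorm x = Num.sqrt (dot x x).
Proof. by congr Num.sqrt; apply: eq_bigr => i _; rewrite expr2. Qed.

Lemma enorm_ge0 x : 0 <= enorm x. Proof. exact: sqrtr_ge0. Qed.

Lemma sqr_enorm x : enorm x ^+ 2 = dot x x.
Proof. by rewrite enormE sqr_sqrtr// dotxx_ge0. Qed.

Lemma enorm_lt x a : 0 < a -> (enorm x < a) = (dot x x < a ^+ 2).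
Proof. by move=> a0; rewrite -sqr_enorm ltr_pXn2r// nnegrE ?enorm_ge0// ltW. Qed.

Lemma enorm_eq x a : 0 <= a -> (enorm x = a) <-> (dot x x = a ^+ 2).
Proof.
move=> a0; rewrite -sqr_enorm; split => [->//|/eqP].
by rewrite eqrXn2// ?enorm_ge0// => /eqP.
Qed.

End dot.

(** * Horoballs and hyperbolic balls in Euclidean terms *)

(** A horoball of Euclidean radius [rho] tangent at [xi] has centre [(1 - rho) *: xi]. Expanding the
    square of [rho *: xi - v] turns membership of [xi - v] into the stated inequality. *)
Lemma horoball_tangent {R : realType} {m : nat} (B : set 'rV[R]_m) :
  horoball B -> exists rho xi, [/\ 0 < rho < 1, dot xi xi = 1 &
    forall v, dot v v < 2 * rho * dot xi v -> B (xi - v)].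
Proof.
move=> [a [r [r0 -> ball_sub [xi sphere_xi]]]].
have [xia xi1] : (esphere a r `&` unit_sphere) xi by rewrite sphere_xi.
have {}xia : dot (xi - a) (xi - a) = r ^+ 2.
  by apply/enorm_eq => //; exact: ltW.
have {}xi1 : dot xi xi = 1.
  by move: xi1; rewrite /unit_sphere /esphere/= subr0 => /(enorm_eq _ _ ler01); rewrite expr1n.
(* A centre at the origin would force [r = 1], and then [- xi] would be a second tangency point. *)
have [a0|a0] := eqVneq a 0.
  have r1 : r ^+ 2 = 1 by rewrite -xia a0 subr0.
  have : (esphere a r `&` unit_sphere) (- xi).
    split; last by apply/enorm_eq => //; rewrite subr0 !dotE opprK xi1 expr1n.
    by apply/enorm_eq; rewrite ?ltW// a0 subr0 !dotE opprK xi1.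
  rewrite sphere_xi => /= xiN.
  by have := dotNl xi xi; rewrite xiN xi1; lra.
set al := enorm a.
have al0 : 0 < al.
  rewrite lt_neqAle enorm_ge0 andbT eq_sym; apply: contra_neq a0 => al0.
  by apply: dotxx_eq0; rewrite -sqr_enorm -/al al0 expr0n.
have aa : dot a a = al ^+ 2 by rewrite sqr_enorm.
have alr1 : al + r <= 1.
  rewrite leNgt; apply/negP => alr.
  have al1 : al < 1.
    have := ball_sub a; rewrite /unit_ball /eball/= subr0; apply.
    by rewrite enorm_lt// !dotE; have := exprn_gt0 2 r0; lra.
  (* The point of the unit sphere nearest to [a] is at distance [1 - al < r], yet it is outside the
     open unit ball. *)
  suff /ball_sub : eball a r (al^-1 *: a).
    rewrite /unit_ball /eball/= subr0 enorm_lt// !dotE aa expr1n.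
    have -> : al^-1 * (al^-1 * al ^+ 2) = 1 by field; rewrite gt_eqF.
    by rewrite ltxx.
  rewrite /eball/= enorm_lt// !dotE aa -subr_gt0.
  rewrite (_ : _ - _ = (al + r - 1) * (r + (1 - al))).
    by rewrite mulr_gt0//; lra.
  by field; rewrite gt_eqF.
(* Equality case of the triangle inequality: [xi] has norm 1 while [al + r <= 1], so [xi - a] is a
   positive multiple of [a]. *)
have w0 : xi - a = (r / al) *: a.
  apply/eqP; rewrite -subr_eq0; apply/eqP/dotxx_eq0/eqP.
  rewrite eq_le dotxx_ge0 andbT.
  move: xia; rewrite !dotE aa xi1 (dotC a xi) => xia.
  rewrite (_ : _ + _ = (r / al) * ((al + r) ^+ 2 - 1)); last first.
    have -> : dot xi a = (1 + al ^+ 2 - r ^+ 2) / 2 by lra.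
    by field; rewrite gt_eqF.
  rewrite pmulr_rle0 ?divr_gt0// subr_le0 expr_le1//; lra.
have xiE : xi = ((al + r) / al) *: a.
  by rewrite mulrDl divff ?gt_eqF// scalerDl scale1r -w0 addrC subrK.
have al_r : al + r = 1.
  apply/eqP; rewrite -(@eqrXn2 _ 2)//; last by lra.
  rewrite expr1n -xi1 xiE !dotE aa; apply/eqP; field; by rewrite gt_eqF.
exists r, xi; split => //; first by apply/andP; split => //; lra.
move=> v hv; rewrite /eball/= enorm_lt//.
have xia' : xi - a = r *: xi.
  by rewrite w0 xiE al_r scalerA mul1r.
rewrite addrAC xia' !dotE xi1 (dotC v); lra.
Qed.

(* The numerator of the fraction in [hdist] is at most 8, and [arcosh u <= ln (2 * u)]. *)
Lemma hball_of_dot {R : realType} {m : nat} (z x : 'rV[R]_m) (r : R) :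
  unit_ball z -> dot x x < 1 ->
  18 < (1 - dot z z) * (1 - dot x x) * expR r -> hball z r x.
Proof.
rewrite /unit_ball /eball/= subr0 enorm_lt// expr1n => z1 x1 hr.
split; first by rewrite /unit_ball /eball/= subr0 enorm_lt// expr1n.
rewrite /hdist !sqr_enorm.
set P := (1 - dot z z) * (1 - dot x x) in hr *.
have z0 := dotxx_ge0 z; have x0 := dotxx_ge0 x.
have P0 : 0 < P by apply: mulr_gt0; lra.
have P1 : P <= 1 by apply: mulr_ile1; lra.
have zx : dot (z - x) (z - x) <= 4.
  have := dotxx_ge0 (z + x); rewrite !dotE (dotC x z); lra.
set W := 1 + _.
have W1 : 1 <= W by rewrite lerDl; apply: divr_ge0; [rewrite pmulr_rge0// dotxx_ge0|exact: ltW].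
(* [W * P] is [P] plus the numerator, at most 1 + 8. Doubling gives the 18 of the hypothesis. *)
have WP : W * P <= 9.
  by rewrite /W mulrDl mul1r divfK ?gt_eqF//; lra.
rewrite /arcosh -[ltRHS]expRK ltr_ln ?posrE ?expR_gt0//; last first.
  by rewrite ltr_pwDl ?sqrtr_ge0//; lra.
have sW : Num.sqrt (W ^+ 2 - 1) <= W.
  rewrite -[leRHS]ger0_norm -?sqrtr_sqr; last by lra.
  by rewrite ler_wsqrtr// gerBl.
rewrite -(ltr_pM2r P0) mulrC (mulrC (expR r)).
nra.
Qed.

(** * Packing cubes into a horoball *)

Lemma normr_dot_le {R : realType} {m : nat} (x y : 'rV[R]_m) (a b : R) :
  (forall j, `|x ord0 j| <= a) -> (forall j, `|y ord0 j| <= b) ->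
  `|dot x y| <= m%:R * (a * b).
Proof.
move=> xa yb; apply: (le_trans (ler_norm_sum _ _ _)).
have -> : m%:R * (a * b) = \sum_(j < m) a * b.
  by rewrite sumr_const card_ord mulr_natl.
by apply: ler_sum => j _; rewrite normrM ler_pM.
Qed.

(* [y] points from the tangency point to the corner of a cube, in units of the
   side of the cubes: all its entries but [i0] are the prescribed integers [k],
   and its entry [i0] puts the corner at a fixed depth below the tangent
   hyperplane. *)
Lemma exists_lattice_corner {R : realType} {n N : nat} (xi : 'rV[R]_n.+1)
    (i0 : 'I_n.+1) (k : 'I_n -> 'I_N) :
  (0 < N)%N -> xi ord0 i0 != 0 -> (forall j, `|xi ord0 j| <= 1) ->
  exists y : 'rV[R]_n.+1, [/\ forall j, y ord0 (lift i0 j) = (k j)%:R,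
    dot xi y = - (2 * n.+1%:R) &
    forall j, `|y ord0 j| <= 3 * n.+1%:R / `|xi ord0 i0| * N%:R].
Proof.
move=> N0 xi0 xi1; set w := `|_|.
have w0 : 0 < w by rewrite normr_gt0.
have N1 : 1 <= N%:R :> R by rewrite ler1n.
have n0 : 0 <= n%:R :> R by rewrite ler0n.
have n1 : n.+1%:R = n%:R + 1 :> R by rewrite -natr1.
set S := \sum_(j < n) xi ord0 (lift i0 j) * (k j)%:R.
have kN j : `|(k j)%:R| <= N%:R :> R by rewrite normr_nat ler_nat ltnW.
have SN : `|S| <= n%:R * N%:R.
  apply: (le_trans (ler_norm_sum _ _ _)).
  have -> : n%:R * N%:R = \sum_(j < n) N%:R :> R.
    by rewrite sumr_const card_ord mulr_natl.
  by apply: ler_sum => j _; rewrite normrM -[leRHS]mul1r ler_pM.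
(* The entry [i0] solves the linear equation for [dot xi y], where [S] is the contribution of the
   other entries. *)
exists (\row_j if unlift i0 j is Some j' then (k j')%:R
               else - (2 * n.+1%:R + S) / xi ord0 i0); split.
- by move=> j; rewrite mxE liftK.
- rewrite /dot (bigD1_ord i0)//= mxE unlift_none.
  under eq_bigr do rewrite mxE liftK.
  by rewrite -/S; field.
- move=> j; rewrite mxE; case: unliftP => [j' _|_].
    apply: (le_trans (kN _)); rewrite ler_peMl//.
    by rewrite ler_pdivlMr// mul1r (le_trans (xi1 i0))//; lra.
  rewrite normrM normrN normfV -/w mulrAC ler_pM2r ?invr_gt0//.
  apply: (le_trans (ler_normD _ _)); rewrite ger0_norm; last by lra.
  nra.
Qed.

(** With side [s] of order [N ^- 2], a grid of [N ^ n] cubes has width of order [s * N], that is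
    [sqrt s], so it fits in the horoball at depth of order [s]. The condition on [r] puts this depth
    within reach of [hball z r]. *)
Lemma horoball_volume {R : realType} {n : nat} (A B : set 'rV[R]_n.+1) z :
  horoball B -> B `<=` A -> unit_ball z ->
  exists2 K, 0 < K & forall N r, (0 < N)%N -> K * N%:R ^+ 2 < expR r ->
    ((N%:R ^+ n * (3 * n.+1%:R)^-1 ^+ n.+1)%:E <= hvol (hball z r `&` A))%E.
Proof.
move=> /horoball_tangent[rho [xi [/andP[rho0 rho1] xixi Bxi]]] BA z1.
set M : R := n.+1%:R.
have M1 : 1 <= M by rewrite ler1n.
have D0 : 0 < 1 - dot z z.
  by move: (z1); rewrite /unit_ball /eball/= subr0 enorm_lt// expr1n subr_gt0.
set D := 1 - dot z z in D0.
have xi1 j : `|xi ord0 j| <= 1.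
  rewrite -(@expr_le1 _ 2)// -normrX ger0_norm ?sqr_ge0// -xixi /dot.
  rewrite (bigD1 j)//= -expr2 lerDl sumr_ge0// => i _.
  by rewrite -expr2 sqr_ge0.
have [i0 xi0] : exists i0, xi ord0 i0 != 0.
  apply/existsP; apply: contraT; rewrite negb_exists => /forallP xi0.
  have : dot xi xi = 0.
    by apply: big1 => j _; move: (xi0 j); rewrite negbK => /eqP ->; rewrite mul0r.
  by rewrite xixi => /eqP; rewrite oner_eq0.
set w := `|xi ord0 i0|.
have w0 : 0 < w by rewrite normr_gt0.
have M0 : 0 < M by lra.
have rho1' : 0 < 1 - rho by lra.
(* [s * K0 * N] will bound the entries of [xi - x]: [3 * M / w] comes from the corner and [M / w]
   from the position inside the cube. *)
have [K0 K00 K0E] : exists2 K0, 0 < K0 & K0 = 4 * M / w.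
  by exists (4 * M / w) => //; rewrite divr_gt0// mulr_gt0.
exists (9 * K0 ^+ 2 / (D * (1 - rho) * rho * M)).
  by rewrite divr_gt0// !mulr_gt0.
move=> N r N0 KN.
have N0' : 0 < N%:R :> R by rewrite ltr0n.
have N1 : 1 <= N%:R :> R by rewrite ler1n.
(* This [s] makes the bound [M * (s * K0 * N) ^ 2] on [dot v v] equal to [M * s * rho]. *)
have [s s0 sE] : exists2 s, 0 < s & s * K0 ^+ 2 * N%:R ^+ 2 = rho.
  exists (rho / (K0 ^+ 2 * N%:R ^+ 2)).
    by rewrite divr_gt0// !mulr_gt0.
  by field; rewrite !gt_eqF.
have sr : 9 < D * (1 - rho) * M * s * expR r.
  have := KN; rewrite mulrAC ltr_pdivrMr; last by rewrite !mulr_gt0.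
  rewrite -sE => KN'.
  have KN0 : 0 < K0 ^+ 2 * N%:R ^+ 2 by rewrite !mulr_gt0.
  rewrite -(ltr_pM2r KN0); move: KN'; rewrite -!mulrA; lra.
pose y (k : {ffun 'I_n -> 'I_N}) := projT1 (cid (exists_lattice_corner xi i0 k N0 xi0 xi1)).
have yP (k : {ffun 'I_n -> 'I_N}) : [/\ forall j, y k ord0 (lift i0 j) = (k j)%:R,
    dot xi (y k) = - (2 * M) & forall j, `|y k ord0 j| <= 3 * M / w * N%:R].
  exact: projT2 (cid (exists_lattice_corner xi i0 k N0 xi0 xi1)).
(* The cubes are indexed by the [N ^ n] integer grid points, and [(3 * M * s)^-1] is the lower bound
   for the conformal factor. *)
have -> : N%:R ^+ n * (3 * M)^-1 ^+ n.+1 =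
    #|{ffun 'I_n -> 'I_N}|%:R * (s ^+ n.+1 * (3 * M * s)^-1 ^+ n.+1).
  rewrite card_ffun !card_ord natrX -exprMn; congr (_ * _ ^+ _).
  by field; rewrite !gt_eqF.
apply: (@hvol_ge_cubes _ _ _ (fun k j => xi ord0 j + s * y k ord0 j)).
- exact: ltW.
- by rewrite exprn_ge0// invr_ge0 !mulr_ge0//; lra.
- by move=> x [[]].
- move=> k k' kk'.
  have [j kj] : exists j, k j != k' j.
    apply/existsP; apply: contraT; rewrite negb_exists => /forallP eqk.
    move: kk'; rewrite (_ : k = k') ?eqxx//; apply/ffunP => j.
    by apply/eqP; move: (eqk j); rewrite negbK.
  exists (lift i0 j); have [-> _ _] := yP k; have [-> _ _] := yP k'.
  rewrite opprD addrACA subrr add0r -mulrBr normrM gtr0_norm// ler_peMr//.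
    exact: ltW.
  have -> : (k j)%:R - (k' j)%:R = ((k j)%:Z - (k' j)%:Z)%:~R :> R.
    by rewrite intrB.
  rewrite -intr_norm (_ : 1 = 1%:~R)// ler_int.
  have : (k j)%:Z - (k' j)%:Z != 0 by rewrite subr_eq0.
  by rewrite -normr_gt0 gtz0_ge1.
move=> k x xc; have [_ xiy yN] := yP k.
have [v vx] : exists v, v = xi - x by exists (xi - x).
have xE : x = xi - v by rewrite vx opprB addrC subrK.
(* [e] is the offset of [x] from the corner of its cube. *)
have [e ex] : exists e, e = x - xi - s *: y k by exists (x - xi - s *: y k).
have es j : `|e ord0 j| <= s.
  have /andP[? ?] := xc j; rewrite ex !mxE ger0_norm; lra.
have vE : v = - (s *: y k + e) by rewrite ex addrCA subrr addr0 vx opprB.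
have u_dist : `|dot xi e| <= M * s by rewrite -[s]mul1r; exact: normr_dot_le.
(* The depth below the tangent hyperplane thus stays between [M * s] and [3 * M * s] on the whole
   cube. *)
have uE : dot xi v = 2 * M * s - dot xi e by rewrite vE !dotE xiy; ring.
have vs j : `|v ord0 j| <= s * K0 * N%:R.
  have -> : v ord0 j = - (s * y k ord0 j + e ord0 j) by rewrite vx ex !mxE; ring.
  rewrite normrN; apply: (le_trans (ler_normD _ _)).
  rewrite normrM (gtr0_norm s0).
  have h1 : s * `|y k ord0 j| <= s * (3 * M / w * N%:R) by rewrite ler_pM2l.
  have h2 : 1 <= M / w * N%:R.
    rewrite mulr_ege1// ler_pdivlMr// mul1r.
    exact: le_trans (xi1 i0) M1.
  have h3 : s <= s * (M / w * N%:R) by rewrite ler_peMr// ltW.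
  have := es j; rewrite K0E; lra.
have vv : dot v v <= M * s * rho.
  have := normr_dot_le v v _ _ vs vs; rewrite ger0_norm ?dotxx_ge0// => /le_trans; apply.
  by rewrite -sE -/M le_eqVlt; apply/orP; left; apply/eqP; ring.
have Ms0 : 0 < M * s by rewrite mulr_gt0//; lra.
move: u_dist; rewrite ler_norml => /andP[u1 u2].
set u := dot xi v in uE.
have uv : dot v v < 2 * rho * u by nra.
have xx : dot x x = 1 - 2 * u + dot v v.
  by rewrite xE !dotE xixi (dotC v xi) -/u; ring.
have urho : 2 * rho * u < 2 * u by nra.
have x1 : dot x x < 1 by lra.
split; first split.
- apply: hball_of_dot => //; rewrite -/D.
  (* Here [1 - dot x x = 2 * u - dot v v] exceeds [2 * (1 - rho) * u], and [u >= M * s]. *)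
  have h : 2 * (1 - rho) * (M * s) <= 1 - dot x x by nra.
  apply: (@lt_le_trans _ _ (D * (2 * (1 - rho) * (M * s)) * expR r)); first by lra.
  by rewrite ler_pM2r ?expR_gt0// ler_pM2l.
- by apply: BA; rewrite xE; exact: Bxi.
have P0 : 0 < 1 - dot x x by lra.
rewrite sqr_enorm lerXn2r// ?nnegrE.
- by rewrite invr_ge0 ltW// -mulrA mulr_gt0.
- by rewrite divr_ge0// ltW.
(* The density bound amounts to [1 - dot x x <= 2 * u <= 6 * M * s]. *)
rewrite ler_pdivlMr// mulrC ler_pdivrMr; last by rewrite -mulrA mulr_gt0.
have := dotxx_ge0 v; lra.
Qed.

(** * From volume growth to entropy *)

Lemma hneighborhood_subset {R : realType} {m : nat} (e : R) (A : set 'rV[R]_m) :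
  0 < e -> A `<=` unit_ball -> A `<=` hneighborhood e A.
Proof.
move=> e0 Aball x Ax; split; first exact: Aball.
exists x => //; rewrite /hdist subrr sqr_enorm -(scale0r 0) dotZl mul0r mulr0 mul0r addr0.
by rewrite /arcosh expr1n subrr sqrtr0 addr0 ln1.
Qed.

(** The logarithm of the lower bound, divided by [r], is [a + ln c / r], which tends to [a]. *)
Lemma limf_esup_lne_ge {R : realType} (f : R -> \bar R) (a c r0 : R) :
  0 < c -> (forall r, r0 <= r -> ((c * expR (a * r))%:E <= f r)%E) ->
  (a%:E <= limf_esup (fun r => lne (f r) * (r^-1)%:E) (pinfty_nbhs R))%E.
Proof.
move=> c0 fc; rewrite limf_esupE; apply: le_ereal_inf_tmp => _ [V [M [_ MV]] <-].
apply/lee_subgt0Pr => eps eps0.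
(* One [r] in the given neighbourhood of infinity suffices; the last bound makes [ln c / r] at least
   [- eps]. *)
pose r := Num.max (Num.max r0 (M + 1)) (Num.max 1 (`|ln c| / eps)).
have [rr0 rM r1 rc] : [/\ r0 <= r, M + 1 <= r, 1 <= r & `|ln c| / eps <= r].
  by rewrite /r !le_max !lexx ?orbT.
have Vr : V r by apply: MV; apply: lt_le_trans rM; rewrite ltrDl.
have r_gt0 : 0 < r by exact: lt_le_trans r1.
apply: (@le_trans _ _ (lne (f r) * (r^-1)%:E)%E); last first.
  by apply: ereal_sup_ubound; exists r.
have cE0 : 0 < c * expR (a * r) by rewrite mulr_gt0 ?expR_gt0.
apply: (@le_trans _ _ (lne (c * expR (a * r))%:E * (r^-1)%:E)%E); last first.
  apply: lee_wpmul2r; first by rewrite lee_fin invr_ge0 ltW.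
  rewrite lee_lne ?fc// in_itv/= leey andbT; first by rewrite lee_fin ltW.
  by apply: le_trans (fc _ rr0); rewrite lee_fin ltW.
rewrite lne_EFin// lnM ?posrE ?expR_gt0// expRK -EFinB -EFinM lee_fin.
rewrite ler_pdivlMr// mulrBl addrC lerD2r.
have := rc; rewrite ler_pdivrMr// mulrC; have := ler_norm (- ln c); rewrite normrN; lra.
Qed.

Lemma core_entropy_ge {R : realType} {n : nat} (L : set 'rV[R]_n.+1) z e :
  (exists2 B, horoball B & B `<=` hull L) -> unit_ball z -> 0 < e ->
  ((n%:R / 2)%:E <= core_entropy_at z e L)%E.
Proof.
move=> [B hB BL] z1 e0.
have Bball : B `<=` unit_ball by case: hB => [a [r []]].
have BA : B `<=` hneighborhood e (hull L).
  move=> x /[dup] Bx /(hneighborhood_subset e B e0 Bball)[x1 [y By xy]].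
  by split=> //; exists y => //; exact: BL.
have [K K0 volK] := horoball_volume _ _ z hB BA z1.
pose k := K + 1.
have k0 : 0 < k by rewrite addr_gt0.
set c := (3 * n.+1%:R)^-1 ^+ n.+1 : R in volK.
have c0 : 0 < c by rewrite exprn_gt0// invr_gt0 mulr_gt0.
(* [N] will be the integer part of [expR (r / 2) / (2 * k)]. The threshold on [r] makes this
   quotient at least 1, so rounding down loses at most a factor 2, whence [4 * k]. *)
apply: (@limf_esup_lne_ge _ _ _ ((4 * k)^-1 ^+ n * c) (2 * ln (2 * k))).
  by rewrite mulr_gt0// exprn_gt0// invr_gt0 mulr_gt0.
move=> r hr.
set E := expR (r / 2).
have rE : expR r = E ^+ 2 by rewrite -expRM_natl; congr expR; field.
have kE : 2 * k <= E.
  rewrite -[leLHS]lnK ?posrE ?mulr_gt0// ler_expR ler_pdivlMr//; lra.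
have Ek1 : 1 <= E / (2 * k) by rewrite ler_pdivlMr ?mulr_gt0// mul1r.
have /andP[NE EN] := truncn_itv (le_trans ler01 Ek1).
set N := Num.truncn _ in NE EN.
have N0 : (0 < N)%N.
  by rewrite lt0n; apply/eqP => N00; move: EN; rewrite N00; lra.
have N1 : 1 <= N%:R :> R by rewrite ler1n.
have kN : 2 * (k * N%:R) <= E.
  by move: NE; rewrite ler_pdivlMr ?mulr_gt0//; lra.
have Nk : E / (4 * k) <= N%:R.
  rewrite ler_pdivrMr ?mulr_gt0//.
  move: EN; rewrite -natr1 ltr_pdivrMr ?mulr_gt0//; nra.
(* The radius condition follows from [K < (2 * k) ^ 2] and [2 * k * N <= E]. *)
apply: le_trans (volK N r N0 _); last first.
  rewrite rE; apply: (@lt_le_trans _ _ ((2 * (k * N%:R)) ^+ 2)).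
    have : K < (2 * k) ^+ 2 by rewrite /k; nra.
    have -> : (2 * (k * N%:R)) ^+ 2 = (2 * k) ^+ 2 * N%:R ^+ 2 by ring.
    by rewrite ltr_pM2r// exprn_gt0// ltr0n.
  by rewrite lerXn2r// nnegrE ?expR_ge0// !mulr_ge0// ltW.
rewrite lee_fin mulrAC ler_pM2r//.
have -> : expR (n%:R / 2 * r) = E ^+ n by rewrite -expRM_natl; congr expR; ring.
rewrite -exprMn mulrC lerXn2r// nnegrE ?ler0n// divr_ge0 ?expR_ge0//.
by rewrite mulr_ge0// ltW.
Qed.

Theorem theorem3p7 (R : realType) (n : nat) (hn : (1 <= n)%N) :
  (forall L : set 'rV[R]_n.+1, closed L -> L `<=` unit_sphere ->
     (exists2 B, horoball B & B `<=` hull L) ->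
     forall (z : 'rV[R]_n.+1) (e : R), unit_ball z -> 0 < e ->
       ((n%:R / 2)%:E <= core_entropy_at z e L)%E) /\
  (forall G : set ('rV[R]_n.+1 -> 'rV[R]_n.+1), kleinian G ->
     forall x0 : 'rV[R]_n.+1, unit_ball x0 ->
     (exists2 B, horoball B & B `<=` hull (limit_set_at G x0)) ->
     forall (z : 'rV[R]_n.+1) (e : R), unit_ball z -> 0 < e ->
       ((n%:R / 2)%:E <= core_entropy_at z e (limit_set_at G x0))%E).
Proof.
split=> [L _ _|G _ x0 _] hull_ball z e; exact: core_entropy_ge.
Qed.
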